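(* Let $(V,\omega)$ be a real symplectic vector space of dimension $2n$, let $L\in\mathcal{L}(V)$, let $U\subset L$ be a linear subspace and let $\rho\in T_L^*\mathcal{L}(V)$. Then $U$ is characteristic for $\rho$ if and only if its annihilator $U^0\subset L^*$ is $g_\rho$-isotropic, i.e. $g_\rho(\alpha,\beta)=0$ for all $\alpha,\beta\in U^0$.
   Context: $\mathcal{L}(V)$ is the smooth manifold of Lagrangian planes of $(V,\omega)$ ($n$-dimensional subspaces on which $\omega$ vanishes). For $\dot L\in T_L\mathcal{L}(V)$ let $\phi_t$ be any one-parameter subgroup of $Sp(V)$ with $\frac{d}{dt}\big|_{t=0}\phi_t(L)=\dot L$ and put $g^{\dot L}(v,w)=\omega\big(\frac{d}{dt}\big|_{t=0}\phi_t(v),w\big)$ for $v,w\in L$; this is a well-defined symmetric bilinear form on $L$, and $\dot L\mapsto g^{\dot L}$ is a linear isomorphism $T_L\mathcal{L}(V)\to S^2(L^* )$. By duality, a covector $\rho\in T_L^*\mathcal{L}(V)$ defines $g_\rho\in S^2(L)$, a symmetric bilinear form on $L^*$: $g_\rho(\alpha,\beta)=\rho(\dot L)$ where $\dot L$ is the tangent vector with $g^{\dot L}=\alpha\vee\beta:=\tfrac12(\alpha\otimes\beta+\beta\otimes\alpha)$. For a subspace $U\subset V$ with $\dim U\le n$, its prolongation is $U^{(1)}=\{L'\in\mathcal{L}(V)\mid L'\supseteq U\}$; for $U$ isotropic it is a smooth submanifold of $\mathcal{L}(V)$. An isotropic subspace $U$ is called characteristic for $\rho\in T_L^*\mathcal{L}(V)$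 if $U\subset L$ and $\rho|_{T_LU^{(1)}}=0$. *)

(* Defs.v *)
From HB Require Import structures.
From mathcomp Require Import all_boot all_order all_algebra.
From mathcomp Require Import all_classical all_reals all_analysis.

Set Implicit Arguments.
Unset Strict Implicit.
Unset Printing Implicit Defensive.

Import Order.TTheory GRing.Theory Num.Theory.
Import numFieldNormedType.Exports.

Local Open Scope classical_set_scope.
Local Open Scope ring_scope.

(* Calculus of curves in a finite-dimensional real vector space, done in
   coordinates: the standard smooth structure does not depend on the basis. *)
Definition vcoord (R : realType) (W : vectType R) (f : R -> W)
    (i : 'I_(\dim {:W})) (t : R) : R :=
  coord (vbasis {:W}) i (f t).

Definition vsmooth_near (R : realType) (W : vectType R) (f : R -> W) (t0 : R)
    : Prop :=
  \forall t \near t0,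
    forall (i : 'I_(\dim {:W})) (k : nat), derivable (derive1n k (vcoord f i)) t 1.

Definition vderiv (R : realType) (W : vectType R) (f : R -> W) (t : R) : W :=
  \sum_(i < \dim {:W}) derive1 (vcoord f i) t *: (vbasis {:W})`_i.

Definition isotropic (R : realType) (V : vectType R)
    (omega : {skew_symmetric V}) (U : {vspace V}) : Prop :=
  forall u v : V, u \in U -> v \in U -> omega u v = 0.

Definition lagrangian (R : realType) (V : vectType R)
    (omega : {skew_symmetric V}) (n : nat) : set {vspace V} :=
  [set L | \dim L = n /\ isotropic omega L].

Definition complementary (R : realType) (V : vectType R) (L M : {vspace V})
    : Prop :=
  (L + M)%VS = fullv /\ (L :&: M)%VS = 0%VS.

(* V / L, realised on a complement of L; [to_quot] is the canonical projection:
   it is onto with kernel L, see [lker_to_quot] and [limg_to_quot]. *)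
Definition quot (R : realType) (V : vectType R) (L : {vspace V}) : vectType R :=
  subvs_of (L^C)%VS.

Definition to_quot (R : realType) (V : vectType R) (L : {vspace V})
    : 'Hom(V, quot L) :=
  linfun (vsproj (L^C)%VS \o daddv_pi (L^C)%VS L).

Lemma lker_to_quot (R : realType) (V : vectType R) (L : {vspace V}) :
  lker (to_quot L) = L.
Proof.
have dLC : (L^C :&: L = 0)%VS by rewrite capvC capv_compl.
have toE (v : V) : vsval (to_quot L v) = daddv_pi (L^C)%VS L v.
  by rewrite /to_quot lfunE /= vsprojK // memv_pi.
have val0 : vsval (0 : subvs_of (L^C)%VS) = 0 by exact: linear0.
have splitE (v : V) : daddv_pi (L^C)%VS L v + daddv_pi L (L^C)%VS v = v.
  by apply: daddv_pi_add dLC _; rewrite addvC addv_complf memvf.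
apply/vspaceP => v; rewrite memv_ker; apply/eqP/idP => [v0|vL].
  have v1 : daddv_pi (L^C)%VS L v = 0 by rewrite -toE v0; exact: val0.
  by rewrite -(splitE v) v1 add0r memv_pi.
apply/val_inj; rewrite /= toE; apply: etrans (esym val0).
by have /(canRL (addrK _)) := splitE v; rewrite (daddv_pi_id (capv_compl L) vL) subrr.
Qed.

Lemma limg_to_quot (R : realType) (V : vectType R) (L : {vspace V}) :
  limg (to_quot L) = fullv.
Proof.
have dLC : (L^C :&: L = 0)%VS by rewrite capvC capv_compl.
apply/vspaceP => x; rewrite memvf; apply/memv_imgP.
exists (vsval x); first exact: memvf.
by apply/val_inj; rewrite /= /to_quot lfunE /= daddv_pi_id ?subvsP // vsvalK.
Qed.

(* The tangent space of the Grassmannian at L is Hom(L, V / L).  For M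
   complementary to L, an affine chart around L sends L' to the projection
   [daddv_pi L' M] onto L' along M.  The velocity at time 0 of a curve c through
   L sends v in L to the class modulo L of the derivative of the projections,
   applied to v; this does not depend on the chart used. *)
Definition has_velocity (R : realType) (V : vectType R) (L : {vspace V})
    (c : R -> {vspace V}) (X : 'Hom(subvs_of L, quot L)) : Prop :=
  c 0 = L /\
  exists M : {vspace V},
    [/\ \forall t \near (0 : R), complementary (c t) M,
        vsmooth_near (fun t : R => daddv_pi (c t) M) 0
      & forall v : subvs_of L,
          X v = to_quot L (vderiv (fun t : R => daddv_pi (c t) M) 0 (vsval v))].

(* The tangent space at L of a submanifold N of the Grassmannian: velocities of
   the smooth curves in N through L. *)
Definition tangent (R : realType) (V : vectType R) (N : set {vspace V})
    (L : {vspace V}) : set 'Hom(subvs_of L, quot L) :=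
  [set X | exists c : R -> {vspace V},
     (\forall t \near (0 : R), N (c t)) /\ has_velocity c X].

(* A covector is a linear functional on the tangent space of the Lagrangian
   Grassmannian; its values at other elements of Hom(L, V / L) play no role. *)
Definition covector (R : realType) (V : vectType R)
    (omega : {skew_symmetric V}) (n : nat) (L : {vspace V})
    (rho : 'Hom(subvs_of L, quot L) -> R) : Prop :=
  forall (a : R) (X Y : 'Hom(subvs_of L, quot L)),
    tangent (lagrangian omega n) X -> tangent (lagrangian omega n) Y ->
    rho (a *: X + Y) = a * rho X + rho Y.

Definition one_param_Sp (R : realType) (V : vectType R)
    (omega : {skew_symmetric V}) (phi : R -> 'End(V)) : Prop :=
  [/\ phi 0 = \1%VF,
      forall s t : R, phi (s + t) = (phi s \o phi t)%VF,
      forall (t : R) (v w : V), omega (phi t v) (phi t w) = omega v w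
    & forall t : R, vsmooth_near phi t].

(* The form g^X, computed from the infinitesimal generator A of any
   one-parameter subgroup that moves L with velocity X. *)
Definition gform (R : realType) (V : vectType R)
    (omega : {skew_symmetric V}) (L : {vspace V})
    (X : 'Hom(subvs_of L, quot L)) (v w : subvs_of L) : R :=
  let A : 'End(V) := xget 0
    [set A : 'End(V) | exists phi : R -> 'End(V),
       [/\ one_param_Sp omega phi,
           has_velocity (fun t : R => (phi t @: L)%VS) X
         & A = vderiv phi 0]] in
  omega (A (vsval v)) (vsval w).

Definition symprod (R : realType) (E : vectType R) (alpha beta : 'Hom(E, R^o))
    (v w : E) : R :=
  2^-1 * ((alpha v : R) * (beta w : R) + (beta v : R) * (alpha w : R)).

(* The form g_rho on the dual of L: rho evaluated at the tangent vector X such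
   that g^X is the symmetric product of alpha and beta. *)
Definition grho (R : realType) (V : vectType R)
    (omega : {skew_symmetric V}) (n : nat) (L : {vspace V})
    (rho : 'Hom(subvs_of L, quot L) -> R)
    (alpha beta : 'Hom(subvs_of L, R^o)) : R :=
  rho (xget 0
    [set X : 'Hom(subvs_of L, quot L) |
       tangent (lagrangian omega n) X /\
       forall v w : subvs_of L, gform omega X v w = symprod alpha beta v w]).

Definition prolongation (R : realType) (V : vectType R)
    (omega : {skew_symmetric V}) (n : nat) (U : {vspace V}) : set {vspace V} :=
  [set L' | lagrangian omega n L' /\ (U <= L')%VS].

Definition characteristic (R : realType) (V : vectType R)
    (omega : {skew_symmetric V}) (n : nat) (L : {vspace V})
    (rho : 'Hom(subvs_of L, quot L) -> R) (U : {vspace V}) : Prop :=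
  [/\ isotropic omega U, (U <= L)%VS
    & forall X : 'Hom(subvs_of L, quot L),
        tangent (prolongation omega n U) X -> rho X = 0].

Definition annihilator (R : realType) (V : vectType R) (L U : {vspace V})
    : set 'Hom(subvs_of L, R^o) :=
  [set alpha | forall u : subvs_of L, vsval u \in U -> alpha u = 0].

(* Main.v *)
From HB Require Import structures.
Require Import Defs.
From mathcomp Require Import all_boot all_order all_algebra.
From mathcomp Require Import all_classical all_reals all_analysis.
From mathcomp Require Import ring.

Set Implicit Arguments.
Unset Strict Implicit.
Unset Printing Implicit Defensive.

Import Order.TTheory GRing.Theory Num.Theory.
Import numFieldNormedType.Exports.

Local Open Scope classical_set_scope.
Local Open Scope ring_scope.

(** The velocity X of a curve through L in the Grassmannian is a linear map from
    L to V / L.  Since L is isotropic, omega (X v) w is well defined for v, w in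
    L; this bilinear form is [hform].  As L is its own orthogonal, X is
    determined by its form ([hform_inj]), and every symmetric form is the form of
    some X ([hform_surj]).

    The whole proof is a translation into these forms.

    - X is tangent to the Lagrangian Grassmannian if and only if its form is
      symmetric ([tangent_lagrangianP]).  The symmetry follows by
      differentiating omega (P_t v) (P_t w) = 0, where P_t is the projection onto
      the plane of the curve at time t along a fixed complement.  Conversely,
      completing a basis of L to a Darboux basis, a symmetric form on L is
      extended to an element A of the symplectic Lie algebra with A o A = 0
      ([hamiltonian_extension]), so that the one-parameter subgroup it generates
      is the affine curve 1 + t A, and this subgroup moves L with velocity X
      ([symmetric_form_flow]).

    - The form g^X of such an X is [hform] X, whichever subgroup is used to
      compute it ([gformE]): differentiate P_t (phi_t v) = phi_t v.

    - X is tangent to the prolongation of U if and only if moreover its form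
      vanishes as soon as one argument lies in U.  If the curve contains U, then
      P_t u = u has derivative 0; conversely, A then kills U, so the planes
      (1 + t A) L all contain U.

    If U is characteristic and alpha, beta annihilate U, the tangent vector X
    whose form is the symmetric product of alpha and beta is therefore tangent
    to the prolongation of U, and rho X = 0.  For the converse, a symmetric form
    that vanishes on U is a linear combination of symmetric products of elements
    of the annihilator of U ([symmetric_form_decomposition]); by injectivity of
    X |-> [hform] X and linearity of rho, rho then vanishes on every tangent
    vector of the prolongation. *)

(** * Linear maps and curves in coordinates *)

Lemma scalar_sum (K : fieldType) (W : lmodType K) (f : W -> K) (I : finType)
    (c : I -> K) (v : I -> W) :
  scalar f -> f (\sum_i c i *: v i) = \sum_i c i * f (v i).
Proof.
move=> flin.
pose F : {scalar W} := HB.pack f (GRing.isLinear.Build _ _ _ _ f flin).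
rewrite -[f]/(F : W -> K) linear_sum; apply: eq_bigr => i _.
by rewrite linearZ.
Qed.

Lemma linfun_exists (K : fieldType) (W1 W2 : vectType K) (f : W1 -> W2) :
  linear f -> exists F : 'Hom(W1, W2), F =1 f.
Proof.
move=> flin.
pose F : {linear W1 -> W2} := HB.pack f (GRing.isLinear.Build _ _ _ _ f flin).
by exists (linfun F) => x; rewrite lfunE.
Qed.

(** Unlike [vderiv], which is a total function, this asserts that the derivative
    exists. *)
Definition has_vderiv (R : realType) (W : vectType R) (f : R -> W) (t : R)
    (d : W) : Prop :=
  forall i, is_derive t 1 (vcoord f i) (coord (vbasis {:W}) i d).

Lemma coord_vderiv (R : realType) (W : vectType R) (f : R -> W) (t : R) i :
  coord (vbasis {:W}) i (vderiv f t) = derive1 (vcoord f i) t.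
Proof. by rewrite coord_sum_free ?(basis_free (vbasisP _)). Qed.

Lemma vsmooth_has_vderiv (R : realType) (W : vectType R) (f : R -> W) (t : R) :
  vsmooth_near f t -> has_vderiv f t (vderiv f t).
Proof.
move=> fs i; have /(_ i 0%N) := nbhs_singleton fs.
move=> /derivableP; rewrite coord_vderiv derive1E => h; exact: h.
Qed.

Lemma has_vderiv_cst (R : realType) (W : vectType R) (a : W) (t : R) :
  has_vderiv (fun=> a) t 0.
Proof. by move=> i; rewrite linear0; exact: is_derive_cst. Qed.

(** The product rule, meant for forms [B] that evaluate endomorphisms on fixed
    vectors and pair the results by omega. *)
Lemma is_derive_bilinear (R : realType) (W1 W2 : vectType R)
    (B : W1 -> W2 -> R) (f : R -> W1) (g : R -> W2) (t : R)
    (df : W1) (dg : W2) :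
  (forall x, scalar (B x)) -> (forall y, scalar (B^~ y)) ->
  has_vderiv f t df -> has_vderiv g t dg ->
  is_derive t 1 (fun s => B (f s) (g s)) (B df (g t) + B (f t) dg).
Proof.
move=> Br Bl fd gd.
pose e1 i := (vbasis {:W1})`_i; pose e2 j := (vbasis {:W2})`_j.
have BE x y : B x y = \sum_i \sum_j coord (vbasis {:W1}) i x *
    (coord (vbasis {:W2}) j y * B (e1 i) (e2 j)).
  rewrite {1}(coord_vbasis (memvf x)) (scalar_sum _ _ (Bl y)).
  apply: eq_bigr => i _.
  rewrite {1}(coord_vbasis (memvf y)) (scalar_sum _ _ (Br _)).
  by rewrite mulr_sumr.
have -> : (fun s => B (f s) (g s)) =
    \sum_i \sum_j (vcoord f i * (vcoord g j * cst (B (e1 i) (e2 j)))).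
  apply/funext => s; rewrite BE fct_sumE; apply: eq_bigr => i _.
  by rewrite fct_sumE.
have D i j : is_derive t 1 (vcoord f i * (vcoord g j * cst (B (e1 i) (e2 j))))
    (coord (vbasis {:W1}) i df * (vcoord g j t * B (e1 i) (e2 j)) +
     vcoord f i t * (coord (vbasis {:W2}) j dg * B (e1 i) (e2 j))).
  have gc := is_deriveM (gd j) (is_derive_cst (B (e1 i) (e2 j)) t 1).
  apply: is_derive_eq (is_deriveM (fd i) gc) _.
  rewrite scaler0 add0r addrC; congr (_ + _); first exact: mulrC.
  by congr (_ * _); exact: mulrC.
have := is_derive_sum (fun i => is_derive_sum (D i)).
move=> h; apply: is_derive_eq h _.
rewrite !BE -big_split; apply: eq_bigr => i _ /=.
by rewrite -big_split.
Qed.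

Lemma derive_eq_near (R : realType) (f g : R -> R) (t df dg : R) :
  (\forall s \near t, f s = g s) ->
  is_derive t 1 f df -> is_derive t 1 g dg -> df = dg.
Proof.
move=> fg fd gd.
have hd : is_derive t 1 g df by apply: near_eq_is_derive fd; rewrite ?oner_neq0.
by rewrite -(@derive_val _ _ _ _ _ _ _ gd) (@derive_val _ _ _ _ _ _ _ hd).
Qed.

Lemma derive_cst_near (R : realType) (f : R -> R) (t a df : R) :
  (\forall s \near t, f s = a) -> is_derive t 1 f df -> df = 0.
Proof. by move=> fa fd; exact: derive_eq_near fa fd (is_derive_cst a t 1). Qed.

Lemma is_derive_affine (R : realType) (a b t : R) :
  is_derive t 1 (fun t : R => a + t * b) b.
Proof.
have -> : (fun t : R => a + t * b) = cst a + id * cst b by apply/funext.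
apply: is_derive_eq; rewrite add0r scaler0 add0r.
by rewrite /GRing.scale /= mulr1.
Qed.

(** Affine functions are stable under differentiation, which makes affine curves
    smooth by induction on the order. *)
Lemma derive1n_affine (R : realType) (a b : R) (k : nat) :
  exists c d : R, derive1n k (fun t : R => a + t * b) = (fun t => c + t * d).
Proof.
elim: k => [|k [c [d ih]]]; first by exists a, b.
exists d, 0; rewrite /derive1n iterS -/(derive1n k _) ih.
apply/funext => t; rewrite mulr0 addr0 derive1E.
by rewrite (@derive_val _ _ _ _ _ _ _ (is_derive_affine c d t)).
Qed.

Lemma vcoord_affine (R : realType) (W : vectType R) (a b : W) i :
  vcoord (fun t : R => a + t *: b) i =
  (fun t => coord (vbasis {:W}) i a + t * coord (vbasis {:W}) i b).
Proof. by apply/funext => t; rewrite /vcoord linearD linearZ. Qed.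

Lemma vsmooth_affine (R : realType) (W : vectType R) (a b : W) (t : R) :
  vsmooth_near (fun s : R => a + s *: b) t.
Proof.
apply: filterE => s i k; rewrite vcoord_affine.
have [c [d ->]] := derive1n_affine (coord (vbasis {:W}) i a)
  (coord (vbasis {:W}) i b) k.
exact: (@ex_derive _ _ _ _ _ _ _ (is_derive_affine c d s)).
Qed.

Lemma vderiv_affine (R : realType) (W : vectType R) (a b : W) (t : R) :
  vderiv (fun s : R => a + s *: b) t = b.
Proof.
rewrite [RHS](coord_vbasis (memvf b)); apply: eq_bigr => i _.
rewrite vcoord_affine derive1E.
by rewrite (@derive_val _ _ _ _ _ _ _ (is_derive_affine _ _ _)).
Qed.

(** * Symplectic linear algebra *)

Lemma sum_delta (K : nzRingType) (m : nat) (c : 'I_m -> K) (k : 'I_m) :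
  \sum_j c j * (j == k)%:R = c k.
Proof.
rewrite (bigD1 k) //= eqxx mulr1 big1 ?addr0 // => j /negPf->.
by rewrite mulr0.
Qed.

Section SymplecticAlgebra.

Variables (R : realType) (V : vectType R) (omega : {skew_symmetric V}).

Lemma omegaC (u v : V) : omega u v = - omega v u.
Proof. by rewrite hermC /= expr1 mulN1r. Qed.

Lemma omega_scalarr (u : V) : scalar (omega u).
Proof. by move=> a x y; rewrite linearP. Qed.

Lemma omega_scalarl (u : V) : scalar (omega^~ u).
Proof. by move=> a x y; rewrite linearPl. Qed.

Hypothesis omega_sympl : is_psymplectic omega.

Lemma symplectic_nondegenerate (x : V) : (forall y, omega x y = 0) -> x = 0.
Proof.
case: omega_sympl => /eqP nd _ _ x0; apply/eqP; rewrite -memv0 -nd.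
by apply/mem_orthovP => y _.
Qed.

(** The endomorphism x |-> sum_i omega x b_i *: b_i, for a basis b of V, is
    injective by nondegeneracy, hence bijective; a preimage of
    sum_i phi b_i *: b_i represents phi. *)
Lemma symplectic_riesz (phi : V -> R) :
  scalar phi -> exists x, forall y, omega x y = phi y.
Proof.
move=> phi_lin.
pose b (i : 'I_(\dim {:V})) := (vbasis {:V})`_i.
have [F FE] : exists F : 'End(V), F =1 fun x => \sum_i omega x (b i) *: b i.
  apply: linfun_exists => a x y; rewrite scaler_sumr -big_split.
  by apply: eq_bigr => i _; rewrite linearPl /= scalerDl scalerA.
have coordF x i : coord (vbasis {:V}) i (F x) = omega x (b i).
  by rewrite FE coord_sum_free ?(basis_free (vbasisP _)).
have F_inj : lker F == 0%VS.
  apply/eqP/vspaceP => x; rewrite memv_ker memv0; apply/eqP/eqP => [Fx0|->].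
    apply: symplectic_nondegenerate => y; rewrite (coord_vbasis (memvf y)).
    rewrite linear_sumr big1 // => i _.
    by rewrite linearZr /= -/(b i) -coordF Fx0 linear0 mulr0.
  by rewrite linear0.
exists (F^-1%VF (\sum_i phi (b i) *: b i)) => y.
rewrite [in LHS](coord_vbasis (memvf y)) [in RHS](coord_vbasis (memvf y)).
rewrite (scalar_sum _ _ phi_lin) (scalar_sum _ _ (omega_scalarr _)).
apply: eq_bigr => i _; rewrite -/(b i) -coordF lker0_lfunVK //.
by rewrite coord_sum_free ?(basis_free (vbasisP _)).
Qed.

(** Extend the coordinates on L to V by the projection onto L, and represent the
    resulting functionals by omega. *)
Lemma symplectic_dual_family (L : {vspace V}) :
  exists f : 'I_(\dim L) -> V,
    forall i j : 'I_(\dim L), omega (f i) (vbasis L)`_j = (i == j)%:R.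
Proof.
have ex i : exists x, forall y,
    omega x y = coord (vbasis L) i (projv L y).
  apply: symplectic_riesz => a x y; rewrite !linearP; reflexivity.
exists (fun i => projT1 (cid (ex i))) => i j.
case: cid => x /= ->.
rewrite projv_id ?vbasis_mem ?mem_nth ?size_tuple //.
by rewrite coord_free ?(basis_free (vbasisP _)) // eq_sym.
Qed.

(** A Lagrangian plane is its own orthogonal, by counting dimensions: the
    orthogonal of L is the kernel of an endomorphism whose range contains L, so
    its dimension is at most 2 n - n. *)
Lemma lagrangian_maximal (n : nat) (L : {vspace V}) (x : V) :
  \dim {:V} = (2 * n)%N -> lagrangian omega n L ->
  (forall w, w \in L -> omega x w = 0) -> x \in L.
Proof.
move=> dimV [dimL Liso] x0.
pose e (i : 'I_(\dim L)) := (vbasis L)`_i.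
have [F FE] : exists F : 'End(V), F =1 fun y => \sum_i omega y (e i) *: e i.
  apply: linfun_exists => a y z; rewrite scaler_sumr -big_split.
  by apply: eq_bigr => i _; rewrite linearPl /= scalerDl scalerA.
have eL i : e i \in L by rewrite vbasis_mem ?mem_nth ?size_tuple.
have [f fe] := symplectic_dual_family L.
have imF : (L <= limg F)%VS.
  apply/subvP => y yL; rewrite (coord_vbasis yL).
  apply: memv_suml => i _; apply: memvZ; apply/memv_imgP; exists (f i).
    exact: memvf.
  rewrite FE (bigD1 i) //= big1 ?addr0 /e ?fe ?eqxx ?scale1r // => j ji.
  by rewrite fe eq_sym (negPf ji) scale0r.
have kerE y : (forall w, w \in L -> omega y w = 0) -> y \in lker F.
  move=> y0; rewrite memv_ker FE big1 // => i _.
  by rewrite y0 ?scale0r.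
have LK : (L <= lker F)%VS.
  by apply/subvP => y yL; apply: kerE => w wL; apply: Liso.
suff /eqP -> : L == lker F by exact: kerE.
rewrite eqEdim LK /=.
have := limg_ker_dim F fullv; rewrite capfv dimV.
have := dimvS imF; rewrite dimL.
by move=> h1 h2; rewrite -(leq_add2r n) addnn -mul2n -h2 leq_add2l.
Qed.

(** The vectors f_i dual to the basis e of L need not be orthogonal to each
    other.  Replacing f_i by f_i + sum_j (omega f_i f_j / 2) e_j keeps the
    pairings with e and cancels those between the f_i. *)
Lemma lagrangian_darboux (L : {vspace V}) : isotropic omega L ->
  exists g : 'I_(\dim L) -> V,
    (forall i j : 'I_(\dim L), omega (g i) (vbasis L)`_j = (i == j)%:R) /\
    (forall i j : 'I_(\dim L), omega (g i) (g j) = 0).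
Proof.
move=> Liso; have [f fe] := symplectic_dual_family L.
pose e (i : 'I_(\dim L)) := (vbasis L)`_i.
have eL i : e i \in L by rewrite vbasis_mem ?mem_nth ?size_tuple.
have ee i j : omega (e i) (e j) = 0 by exact: Liso.
pose s i := \sum_j (2^-1 * omega (f i) (f j)) *: e j.
have se i j : omega (s i) (e j) = 0.
  rewrite (scalar_sum _ _ (omega_scalarl _)) big1 // => k _.
  by rewrite ee mulr0.
have fs i j : omega (f i) (s j) = 2^-1 * omega (f j) (f i).
  rewrite (scalar_sum _ _ (omega_scalarr _)).
  rewrite -[RHS](sum_delta (fun k => 2^-1 * omega (f j) (f k))).
  by apply: eq_bigr => k _; rewrite fe eq_sym.
have ss i j : omega (s i) (s j) = 0.
  rewrite [omega _ (s j)](scalar_sum _ _ (omega_scalarr _)) big1 // => k _.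
  by rewrite se mulr0.
exists (fun i => f i + s i); split=> i j.
  by rewrite linearDl /= -/(e j) se addr0 fe.
rewrite linearDl linearDr /= linearDr /= ss addr0 fs [omega (s i) _]omegaC fs.
by rewrite [omega (f j) _]omegaC; field.
Qed.

End SymplecticAlgebra.

(** * The bilinear form of a tangent vector *)

(** This is omega (X v) w.  The vector X v is only defined modulo L, and its
    representative in the chosen complement of L is as good as any other by
    [omega_to_quot]. *)
Definition hform (R : realType) (V : vectType R) (omega : {skew_symmetric V})
    (L : {vspace V}) (X : 'Hom(subvs_of L, quot L)) (v w : subvs_of L) : R :=
  omega (vsval (X v)) (vsval w).

Lemma to_quotE (R : realType) (V : vectType R) (L : {vspace V}) (x : V) :
  x - vsval (to_quot L x) \in L.
Proof.
have dLC : (L^C :&: L = 0)%VS by rewrite capvC capv_compl.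
have splitE : daddv_pi (L^C)%VS L x + daddv_pi L (L^C)%VS x = x.
  by apply: daddv_pi_add dLC _; rewrite addvC addv_complf memvf.
have -> : vsval (to_quot L x) = daddv_pi (L^C)%VS L x.
  by rewrite /to_quot lfunE /= vsprojK // memv_pi.
by rewrite -{1}splitE addrC addKr memv_pi.
Qed.

Lemma omega_to_quot (R : realType) (V : vectType R) (omega : {skew_symmetric V})
    (L : {vspace V}) (x w : V) :
  isotropic omega L -> w \in L -> omega (vsval (to_quot L x)) w = omega x w.
Proof.
move=> Liso wL; apply/esym/eqP; rewrite -subr_eq0 -linearBl.
by apply/eqP/Liso => //; exact: to_quotE.
Qed.

Lemma complementary_pi_id (R : realType) (V : vectType R) (L M : {vspace V})
    (x : V) :
  complementary L M -> x \in L -> daddv_pi L M x = x.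
Proof. by move=> [_ LM0]; exact: daddv_pi_id. Qed.

(** Differentiate omega (P_t v) (P_t w) = 0 at 0, where P_t is the projection
    onto the plane of the curve at time t. *)
Lemma tangent_lagrangian_sym (R : realType) (V : vectType R)
    (omega : {skew_symmetric V}) (n : nat) (L : {vspace V})
    (X : 'Hom(subvs_of L, quot L)) :
  isotropic omega L -> tangent (lagrangian omega n) X ->
  forall v w, hform omega X v w = hform omega X w v.
Proof.
move=> Liso [c [c_lagr [c0 [M [cM /vsmooth_has_vderiv Pd XE]]]]] v w.
rewrite /hform !XE !omega_to_quot ?subvsP //.
set P := fun t => daddv_pi (c t) M in Pd *; set P' := vderiv P 0 in Pd *.
pose B (f g : 'End(V)) := omega (f (vsval v)) (g (vsval w)).
have Br f : scalar (B f).
  by move=> a g h; rewrite /B add_lfunE scale_lfunE linearP.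
have Bl f : scalar (B^~ f).
  by move=> a g h; rewrite /B add_lfunE scale_lfunE linearPl.
have P0 x : x \in L -> P 0 x = x.
  by rewrite -{1}c0; apply: complementary_pi_id; exact: (nbhs_singleton cM).
have := @derive_cst_near _ _ _ 0 _ _ (is_derive_bilinear Br Bl Pd Pd).
rewrite /B !P0 ?subvsP // [omega (vsval v) _]omegaC => h.
apply/eqP; rewrite -subr_eq0; apply/eqP/h.
apply: filterS c_lagr => t [_ ct]; apply: ct; exact: memv_pi.
Qed.

(** As the planes of the curve contain U, the projection P_t u = u does not depend
    on t, for u in U. *)
Lemma tangent_prolongation_vanish (R : realType) (V : vectType R)
    (omega : {skew_symmetric V}) (n : nat) (L U : {vspace V})
    (X : 'Hom(subvs_of L, quot L)) :
  isotropic omega L -> tangent (prolongation omega n U) X ->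
  forall u w, vsval u \in U -> hform omega X u w = 0.
Proof.
move=> Liso [c [c_prol [c0 [M [cM /vsmooth_has_vderiv Pd XE]]]]] u w uU.
rewrite /hform !XE !omega_to_quot ?subvsP //.
set P := fun t => daddv_pi (c t) M in Pd *; set P' := vderiv P 0 in Pd *.
pose B (f g : 'End(V)) := omega (f (vsval u)) (g (vsval w)).
have Br f : scalar (B f).
  by move=> a g h; rewrite /B add_lfunE scale_lfunE linearP.
have Bl f : scalar (B^~ f).
  by move=> a g h; rewrite /B add_lfunE scale_lfunE linearPl.
have := @derive_cst_near _ _ _ (omega (vsval u) (vsval w)) _ _
  (is_derive_bilinear Br Bl Pd (has_vderiv_cst (\1%VF : 'End(V)) 0)).
rewrite /B zero_lfunE linear0r addr0 id_lfunE; apply.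
near=> t; rewrite /P complementary_pi_id //; first by near: t.
by have [_ /subvP/(_ _ uU)] : prolongation omega n U (c t) by near: t.
Unshelve. all: by end_near. Qed.

(** Differentiating P_t (phi_t v) = phi_t v at 0, with A the generator of phi,
    gives P' v + P_0 (A v) = A v.  As P_0 has values in L, A v and P' v agree
    modulo L: the form computed from A depends on the velocity only. *)
Lemma generator_hform (R : realType) (V : vectType R)
    (omega : {skew_symmetric V}) (L : {vspace V})
    (X : 'Hom(subvs_of L, quot L)) (phi : R -> 'End(V)) :
  isotropic omega L -> one_param_Sp omega phi ->
  has_velocity (fun t : R => (phi t @: L)%VS) X ->
  forall v w, omega (vderiv phi 0 (vsval v)) (vsval w) = hform omega X v w.
Proof.
move=> Liso [phi0 _ _ phi_smooth].
move=> [c0 [M [cM /vsmooth_has_vderiv Pd XE]]] v w.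
have phid := vsmooth_has_vderiv (phi_smooth 0).
rewrite /hform !XE !omega_to_quot ?subvsP //.
set P := fun t => daddv_pi (phi t @: L)%VS M in Pd *.
set P' := vderiv P 0 in Pd *; set A := vderiv phi 0 in phid *.
pose B (f g : 'End(V)) := omega (f (g (vsval v))) (vsval w).
have Br f : scalar (B f).
  by move=> a g h; rewrite /B add_lfunE scale_lfunE linearP linearPl.
have Bl f : scalar (B^~ f).
  by move=> a g h; rewrite /B add_lfunE scale_lfunE linearPl.
(* The second curve is phi itself, written as a product with a constant. *)
have := derive_eq_near _ (is_derive_bilinear Br Bl Pd phid)
  (is_derive_bilinear Br Bl (has_vderiv_cst (\1%VF : 'End(V)) 0) phid).
rewrite /B phi0 zero_lfunE linear0l add0r !id_lfunE.
have PL : P 0 (A (vsval v)) \in L by rewrite -[in X in _ \in X]c0 memv_pi.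
rewrite (Liso _ _ PL) ?subvsP // addr0 => h; apply/esym/h; near=> t.
rewrite id_lfunE.
rewrite /P complementary_pi_id ?memv_img ?subvsP //.
by near: t.
Unshelve. all: by end_near. Qed.

Lemma quot_omega_inj (R : realType) (V : vectType R)
    (omega : {skew_symmetric V}) (n : nat) (L : {vspace V}) (p q : quot L) :
  is_psymplectic omega -> \dim {:V} = (2 * n)%N -> lagrangian omega n L ->
  (forall w, w \in L -> omega (vsval p) w = omega (vsval q) w) -> p = q.
Proof.
move=> sympl dimV Llagr pq; apply/val_inj/eqP; rewrite -subr_eq0 -memv0.
rewrite -(capv_compl L) memv_cap; apply/andP; split; last first.
  by rewrite memvB ?subvsP.
apply: (lagrangian_maximal sympl dimV Llagr) => w wL.
by rewrite linearBl /= pq // subrr.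
Qed.

Lemma hform_inj (R : realType) (V : vectType R)
    (omega : {skew_symmetric V}) (n : nat) (L : {vspace V})
    (X Y : 'Hom(subvs_of L, quot L)) :
  is_psymplectic omega -> \dim {:V} = (2 * n)%N -> lagrangian omega n L ->
  (forall v w, hform omega X v w = hform omega Y v w) -> X = Y.
Proof.
move=> sympl dimV Llagr XY; apply/lfunP => v.
apply: (quot_omega_inj sympl dimV Llagr) => w wL.
by have := XY v (Subvs wL).
Qed.

Lemma hform_scalarr (R : realType) (V : vectType R) (omega : {skew_symmetric V})
    (L : {vspace V}) (X : 'Hom(subvs_of L, quot L)) v :
  scalar (hform omega X v).
Proof. by move=> a x y; rewrite /hform !linearP. Qed.

Lemma hform_scalarl (R : realType) (V : vectType R) (omega : {skew_symmetric V})
    (L : {vspace V}) (X : 'Hom(subvs_of L, quot L)) w :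
  scalar ((hform omega X)^~ w).
Proof. by move=> a x y; rewrite /hform linearP linearPl. Qed.

Lemma coord_subvs (K : fieldType) (V : vectType K) (L : {vspace V})
    (v : subvs_of L) :
  v = \sum_i coord (vbasis L) i (vsval v) *: vsproj L (vbasis L)`_i.
Proof.
apply: val_inj; rewrite /= [LHS](coord_vbasis (subvsP v)) linear_sum.
apply: eq_bigr => i _; rewrite linearZ /= vsprojK //.
by rewrite vbasis_mem ?mem_nth ?size_tuple.
Qed.

Lemma subvs_bilinear_expand (K : fieldType) (V : vectType K) (L : {vspace V})
    (B : subvs_of L -> subvs_of L -> K) v w :
  (forall x, scalar (B x)) -> (forall y, scalar (B^~ y)) ->
  B v w = \sum_i \sum_j coord (vbasis L) i (vsval v) *
    (coord (vbasis L) j (vsval w) *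
     B (vsproj L (vbasis L)`_i) (vsproj L (vbasis L)`_j)).
Proof.
move=> Br Bl; rewrite {1}(coord_subvs v) (scalar_sum _ _ (Bl w)).
apply: eq_bigr => i _; rewrite {1}(coord_subvs w) (scalar_sum _ _ (Br _)).
by rewrite mulr_sumr.
Qed.

(** * Realizing a symmetric form by a one-parameter subgroup *)

(** With e the basis of L and g a dual isotropic family, put
    A x = sum_ij b e_i e_j (omega g_i x) g_j and p x = sum_i (omega g_i x) e_i.
    Then p is the projection onto L whose kernel, the common orthogonal of
    the g_i, is a complement of L that contains the range of A and is killed by
    A; in particular A o A = 0.  The symmetry of omega (A x) y in x and y says
    that A belongs to the symplectic Lie algebra. *)
Lemma hamiltonian_extension (R : realType) (V : vectType R)
    (omega : {skew_symmetric V}) (L : {vspace V})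
    (b : subvs_of L -> subvs_of L -> R) :
  is_psymplectic omega -> isotropic omega L ->
  (forall x, scalar (b x)) -> (forall y, scalar (b^~ y)) ->
  (forall v w, b v w = b w v) ->
  exists (A : 'End(V)) (p : 'End(V)),
    [/\ forall x y, omega (A x) y = omega (A y) x,
        forall v w : subvs_of L, omega (A (vsval v)) (vsval w) = b v w,
        forall u : subvs_of L, (forall w, b u w = 0) -> A (vsval u) = 0,
        (forall x, x \in L -> p x = x) /\ (forall x, p x \in L)
      & (forall x, p (A x) = 0) /\ (forall x, A (p x) = A x)].
Proof.
move=> sympl Liso br bl bsym.
have [g [ge gg]] := lagrangian_darboux sympl Liso.
pose e (i : 'I_(\dim L)) := (vbasis L)`_i.
pose bb i j := b (vsproj L (e i)) (vsproj L (e j)).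
have eL i : e i \in L by rewrite vbasis_mem ?mem_nth ?size_tuple.
have gE i x : x \in L -> omega (g i) x = coord (vbasis L) i x.
  move=> xL; rewrite {1}(coord_vbasis xL) (scalar_sum _ _ (omega_scalarr _ _)).
  rewrite -[RHS](sum_delta (fun k => coord (vbasis L) k x)).
  by apply: eq_bigr => k _; rewrite ge eq_sym.
have [A AE] : exists A : 'End(V),
    A =1 fun x => \sum_i omega (g i) x *: \sum_j bb i j *: g j.
  apply: linfun_exists => a x y; rewrite scaler_sumr -big_split.
  by apply: eq_bigr => i _; rewrite linearP /= scalerDl scalerA.
have [p pE] : exists p : 'End(V), p =1 fun x => \sum_i omega (g i) x *: e i.
  apply: linfun_exists => a x y; rewrite scaler_sumr -big_split.
  by apply: eq_bigr => i _; rewrite linearP /= scalerDl scalerA.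
have AQ x y : omega (A x) y =
    \sum_i \sum_j omega (g i) x * (omega (g j) y * bb i j).
  rewrite AE (scalar_sum _ _ (omega_scalarl _ _)); apply: eq_bigr => i _.
  rewrite (scalar_sum _ _ (omega_scalarl _ _)) mulr_sumr.
  by apply: eq_bigr => j _; rewrite [bb i j * _]mulrC.
have gA i x : omega (g i) (A x) = 0.
  rewrite omegaC AQ big1 ?oppr0 // => k _; rewrite big1 // => j _.
  by rewrite gg mul0r mulr0.
have pL x : p x \in L.
  by rewrite pE; apply: memv_suml => i _; exact: memvZ.
have gp i x : omega (g i) (p x) = omega (g i) x.
  by rewrite gE // pE coord_sum_free ?(basis_free (vbasisP _)).
exists A, p; split.
- move=> x y; rewrite !AQ exchange_big; apply: eq_bigr => i _.
  apply: eq_bigr => j _; rewrite mulrCA; congr (_ * (_ * _)); exact: bsym.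
- move=> v w; rewrite AQ (subvs_bilinear_expand _ _ br bl).
  by apply: eq_bigr => i _; apply: eq_bigr => j _; rewrite !gE ?subvsP.
- move=> u u0; rewrite AE.
  under eq_bigr do rewrite scaler_sumr.
  rewrite exchange_big big1 // => j _.
  under eq_bigr do rewrite scalerA gE ?subvsP //.
  rewrite -scaler_suml -[X in X *: _](scalar_sum _ _ (bl _)).
  by rewrite -coord_subvs u0 scale0r.
- split=> // x xL; rewrite pE [RHS](coord_vbasis xL).
  by apply: eq_bigr => i _; rewrite gE.
- split=> x; first by rewrite pE big1 // => i _; rewrite gA scale0r.
  by rewrite !AE; apply: eq_bigr => i _; rewrite gp.
Qed.

Lemma complementary_pi_unique (R : realType) (V : vectType R)
    (L M : {vspace V}) (x y : V) :
  complementary L M -> y \in L -> x - y \in M -> daddv_pi L M x = y.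
Proof.
move=> [LMf LM0] yL xyM; rewrite -[x](subrK y) linearD /= (daddv_pi_id LM0 yL).
have ML0 : (M :&: L = 0)%VS by rewrite capvC.
have := daddv_pi_add LM0 (_ : x - y \in (L + M)%VS).
rewrite LMf memvf (daddv_pi_id ML0 xyM) => /(_ isT) /(canRL (addrK _)) ->.
by rewrite subrr add0r.
Qed.

(** The subgroup is phi_t = 1 + t A with A from [hamiltonian_extension].  The
    kernel of p is a complement of all the planes phi_t L, and the projection
    onto phi_t L along it is p + t A, an affine curve with derivative A.  The
    last clause keeps phi_t L inside the prolongation of any U on which the form
    vanishes. *)
Lemma symmetric_form_flow (R : realType) (V : vectType R)
    (omega : {skew_symmetric V}) (n : nat) (L : {vspace V})
    (X : 'Hom(subvs_of L, quot L)) :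
  is_psymplectic omega -> \dim {:V} = (2 * n)%N -> lagrangian omega n L ->
  (forall v w, hform omega X v w = hform omega X w v) ->
  exists phi : R -> 'End(V),
    [/\ one_param_Sp omega phi,
        has_velocity (fun t : R => (phi t @: L)%VS) X,
        forall t, lagrangian omega n (phi t @: L)%VS
      & forall u, (forall w, hform omega X u w = 0) ->
        forall t, phi t (vsval u) = vsval u].
Proof.
move=> sympl dimV Llagr Xsym; have [dimL Liso] := Llagr.
have [A [p [AC AX A0 [pid pL] [pA Ap]]]] := hamiltonian_extension sympl Liso
  (hform_scalarr omega X) (hform_scalarl omega X) Xsym.
have AA x : A (A x) = 0 by rewrite -Ap pA linear0.
pose phi (t : R) : 'End(V) := \1%VF + t *: A.
have phiE t x : phi t x = x + t *: A x.
  by rewrite add_lfunE scale_lfunE id_lfunE.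
have phi0 : phi 0 = \1%VF by rewrite /phi scale0r addr0.
have phiD s t : phi (s + t) = (phi s \o phi t)%VF.
  apply/lfunP => x; rewrite comp_lfunE !phiE linearD linearZ /= AA scaler0.
  by rewrite addr0 scalerDl -addrA [t *: _ + _]addrC.
have phi_omega t v w : omega (phi t v) (phi t w) = omega v w.
  rewrite !phiE linearDl !linearDr linearZl !linearZr /= linearZl /=.
  rewrite [omega v (A w)]omegaC AC [omega (A v) (A w)]AC.
  by rewrite AA linear0l !mulr0 addr0 mulrN addrAC -addrA subrr addr0.
have phi_inj t : lker (phi t) == 0%VS.
  apply/lker0P => x y /(congr1 (phi (- t))).
  by rewrite -!comp_lfunE -phiD addNr phi0 !id_lfunE.
exists phi; split.
- split=> // t; exact: vsmooth_affine.
- split; first by rewrite phi0 lim1g.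
  have cplt t : complementary (phi t @: L)%VS (lker p).
    split.
      apply/vspaceP => x; rewrite memvf.
      rewrite -[x](subrK (phi t (p x))) addrC; apply: memv_add.
        exact: memv_img.
      rewrite memv_ker linearB /= phiE linearD linearZ /= pA scaler0 addr0.
      by rewrite (pid _ (pL x)) subrr.
    apply/eqP; rewrite -subv0; apply/subvP => x; rewrite memv_cap memv_ker.
    case/andP => /memv_imgP[y yL ->].
    rewrite phiE linearD linearZ /= pA scaler0 addr0 pid // => /eqP ->.
    by rewrite linear0 scaler0 addr0 mem0v.
  have piE : (fun t => daddv_pi (phi t @: L)%VS (lker p)) =
      (fun t : R => p + t *: A).
    apply/funext => t; apply/lfunP => x.
    have -> : (p + t *: A) x = phi t (p x).
      by rewrite add_lfunE scale_lfunE phiE Ap.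
    apply: complementary_pi_unique (cplt t) (memv_img _ (pL x)) _.
    rewrite memv_ker linearB /= phiE linearD linearZ /= pA scaler0 addr0.
    by rewrite (pid _ (pL x)) subrr.
  exists (lker p); rewrite piE; split.
  + by apply: filterE.
  + exact: vsmooth_affine.
  + move=> v; apply: (quot_omega_inj sympl dimV Llagr) => w wL.
    rewrite vderiv_affine omega_to_quot //.
    by rewrite (AX v (Subvs wL)).
- move=> t; split; first by rewrite limg_dim_eq // (eqP (phi_inj t)) capv0.
  move=> _ _ /memv_imgP[x xL ->] /memv_imgP[y yL ->].
  by rewrite phi_omega; exact: Liso.
- by move=> u u0 t; rewrite phiE A0 // scaler0 addr0.
Qed.

Lemma hform_surj (R : realType) (V : vectType R)
    (omega : {skew_symmetric V}) (L : {vspace V})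
    (b : subvs_of L -> subvs_of L -> R) :
  is_psymplectic omega -> isotropic omega L ->
  (forall x, scalar (b x)) -> (forall y, scalar (b^~ y)) ->
  (forall v w, b v w = b w v) ->
  exists X : 'Hom(subvs_of L, quot L), forall v w, hform omega X v w = b v w.
Proof.
move=> sympl Liso br bl bsym.
have [A [_ [_ AX _ _ _]]] := hamiltonian_extension sympl Liso br bl bsym.
have [X XE] : exists X : 'Hom(subvs_of L, quot L),
    X =1 fun v => to_quot L (A (vsval v)).
  by apply: linfun_exists => a x y; rewrite !linearP.
by exists X => v w; rewrite /hform XE omega_to_quot ?subvsP.
Qed.

Lemma hform_scalar (R : realType) (V : vectType R) (omega : {skew_symmetric V})
    (L : {vspace V}) (v w : subvs_of L) :
  scalar (fun X : 'Hom(subvs_of L, quot L) => hform omega X v w).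
Proof.
by move=> a X Y; rewrite /hform add_lfunE scale_lfunE linearP linearPl.
Qed.

(** * Symmetric products of linear forms *)

Lemma symprod_scalarr (R : realType) (E : vectType R)
    (alpha beta : 'Hom(E, R^o)) (v : E) : scalar (symprod alpha beta v).
Proof.
by move=> a x y; rewrite /symprod !linearP /= /GRing.scale /=; ring.
Qed.

Lemma symprodC (R : realType) (E : vectType R)
    (alpha beta : 'Hom(E, R^o)) (v w : E) :
  symprod alpha beta v w = symprod alpha beta w v.
Proof. by rewrite /symprod; ring. Qed.

Lemma symprod_scalarl (R : realType) (E : vectType R)
    (alpha beta : 'Hom(E, R^o)) (w : E) : scalar ((symprod alpha beta)^~ w).
Proof. by move=> a x y; rewrite ![symprod _ _ _ w]symprodC symprod_scalarr. Qed.

(** Let q be the projection v |-> v - P_U v of L along U.  As b vanishes on U,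
    b v w = b (q v) (q w); expanding in the basis e of L yields
    b = sum_ij b e_i e_j (alpha_i x alpha_j), where alpha_i is the i-th
    coordinate of q and so annihilates U.  Since b is symmetric, the tensor
    products may be replaced by symmetric products. *)
Lemma symmetric_form_decomposition (R : realType) (V : vectType R)
    (L U : {vspace V}) (b : subvs_of L -> subvs_of L -> R) :
  (U <= L)%VS ->
  (forall x, scalar (b x)) -> (forall y, scalar (b^~ y)) ->
  (forall v w, b v w = b w v) ->
  (forall u w, vsval u \in U -> b u w = 0) ->
  exists (c : 'I_(\dim L) * 'I_(\dim L) -> R)
    (alpha : 'I_(\dim L) -> 'Hom(subvs_of L, R^o)),
    (forall i, annihilator U (alpha i)) /\
    forall v w, b v w = \sum_k c k * symprod (alpha k.1) (alpha k.2) v w.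
Proof.
move=> UL br bl bsym bU.
have [q qE] : exists q : 'End(subvs_of L),
    q =1 fun v => v - vsproj L (projv U (vsval v)).
  apply: linfun_exists => a x y; rewrite !linearP /=.
  by rewrite scalerDr addrACA.
have ex i : exists al : 'Hom(subvs_of L, R^o),
    al =1 fun v => coord (vbasis L) i (vsval (q v)).
  by apply: linfun_exists => a x y; rewrite !linearP.
pose alpha i := projT1 (cid (ex i)).
have alphaE i v : alpha i v = coord (vbasis L) i (vsval (q v)).
  by rewrite /alpha; case: cid.
pose e (i : 'I_(\dim L)) := vsproj L (vbasis L)`_i.
exists (fun k => b (e k.1) (e k.2)), alpha; split=> [i u uU|v w].
  by rewrite alphaE qE projv_id // vsvalK subrr !linear0.
have bq v' w' : b v' w' = b (q v') w'.
  rewrite qE -[X in b X _](subrK (vsproj L (projv U (vsval v')))).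
  rewrite -[X in b (X + _) _]scale1r bl mul1r [b (vsproj _ _) _]bU ?addr0 //.
  by rewrite vsprojK ?memv_proj // (subvP UL) ?memv_proj.
have bE v' w' : b v' w' =
    \sum_i \sum_j b (e i) (e j) * ((alpha i v' : R) * (alpha j w' : R)).
  rewrite bq bsym bq bsym (subvs_bilinear_expand _ _ br bl).
  apply: eq_bigr => i _; apply: eq_bigr => j _.
  by rewrite !alphaE [RHS]mulrC mulrA.
have -> : b v w = 2^-1 * (b v w + b w v) by rewrite -bsym; field.
rewrite !bE.
rewrite -(pair_bigA _
  (fun i j => b (e i) (e j) * symprod (alpha i) (alpha j) v w)) /=.
rewrite -big_split mulr_sumr; apply: eq_bigr => i _.
rewrite -big_split mulr_sumr; apply: eq_bigr => j _ /=.
by rewrite /symprod; ring.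
Qed.

(** * Tangent vectors of the Lagrangian Grassmannian *)

Section LagrangianTangent.

Variables (R : realType) (V : vectType R) (omega : {skew_symmetric V}).
Variables (n : nat) (L : {vspace V}).
Hypotheses (sympl : is_psymplectic omega) (dimV : \dim {:V} = (2 * n)%N).
Hypothesis (Llagr : lagrangian omega n L).

Lemma tangent_lagrangianP (X : 'Hom(subvs_of L, quot L)) :
  tangent (lagrangian omega n) X <->
  forall v w, hform omega X v w = hform omega X w v.
Proof.
split; first exact: tangent_lagrangian_sym Llagr.2.
move=> /(symmetric_form_flow sympl dimV Llagr)[phi [_ vel lagr _]].
by exists (fun t => (phi t @: L)%VS); split=> //; exact: filterE.
Qed.

Lemma tangent_prolongation (U : {vspace V}) (X : 'Hom(subvs_of L, quot L)) :
  (U <= L)%VS -> tangent (lagrangian omega n) X ->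
  (forall u w, vsval u \in U -> hform omega X u w = 0) ->
  tangent (prolongation omega n U) X.
Proof.
move=> UL /tangent_lagrangianP Xsym XU.
have [phi [_ vel lagr fix_phi]] := symmetric_form_flow sympl dimV Llagr Xsym.
exists (fun t => (phi t @: L)%VS); split=> //; apply: filterE => t; split=> //.
apply/subvP => u uU; have uL := subvP UL u uU.
rewrite -[u]/(vsval (Subvs uL)) -(fix_phi _ _ t) ?memv_img ?subvsP //.
by move=> w; exact: XU.
Qed.

Lemma gformE (X : 'Hom(subvs_of L, quot L)) :
  tangent (lagrangian omega n) X ->
  forall v w, gform omega X v w = hform omega X v w.
Proof.
move=> /tangent_lagrangianP Xsym v w; rewrite /gform; case: xgetP.
  move=> A _ [phi [phi_Sp vel ->]].
  exact: generator_hform Llagr.2 phi_Sp vel v w.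
have [phi [phi_Sp vel _ _]] := symmetric_form_flow sympl dimV Llagr Xsym.
by move=> none; case: (none (vderiv phi 0)); exists phi.
Qed.

(** As the set from which [grho] chooses is nonempty, by [hform_surj], the chosen
    vector does belong to it. *)
Lemma grhoE (rho : 'Hom(subvs_of L, quot L) -> R)
    (alpha beta : 'Hom(subvs_of L, R^o)) :
  exists X, [/\ tangent (lagrangian omega n) X,
    forall v w, hform omega X v w = symprod alpha beta v w
  & grho omega n rho alpha beta = rho X].
Proof.
rewrite /grho; case: xgetP => [X _ [Xtan XE]|none].
  by exists X; split=> // v w; rewrite -gformE.
have [X XE] := hform_surj sympl Llagr.2 (symprod_scalarr alpha beta)
  (symprod_scalarl alpha beta) (symprodC alpha beta).
have Xtan : tangent (lagrangian omega n) X.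
  by apply/tangent_lagrangianP => v w; rewrite !XE symprodC.
by case: (none X); split=> // v w; rewrite gformE.
Qed.

Lemma covector_sum (rho : 'Hom(subvs_of L, quot L) -> R) (I : finType)
    (c : I -> R) (X : I -> 'Hom(subvs_of L, quot L)) :
  covector omega n rho -> (forall k, tangent (lagrangian omega n) (X k)) ->
  rho (\sum_k c k *: X k) = \sum_k c k * rho (X k).
Proof.
move=> rho_cov Xtan.
have tan0 : tangent (lagrangian omega n) (0 : 'Hom(subvs_of L, quot L)).
  by apply/tangent_lagrangianP => v w; rewrite /hform !zero_lfunE !linear0l.
have rho0 : rho 0 = 0.
  have := rho_cov 1 _ _ tan0 tan0; rewrite scaler0 addr0 mul1r => h.
  by apply: (addrI (rho 0)); rewrite addr0 -h.
suff [] : tangent (lagrangian omega n) (\sum_k c k *: X k) /\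
    rho (\sum_k c k *: X k) = \sum_k c k * rho (X k) by [].
elim: (index_enum I) => [|k r [tan_r IH]]; first by rewrite !big_nil.
rewrite !big_cons rho_cov // IH; split=> //.
apply/tangent_lagrangianP => v w; rewrite !hform_scalar.
have /tangent_lagrangianP -> := Xtan k.
by have /tangent_lagrangianP -> := tan_r.
Qed.

End LagrangianTangent.

(** * Characteristic subspaces *)

Theorem theorem3p7 (R : realType) (V : vectType R)
    (omega : {skew_symmetric V}) (n : nat)
    (omega_sympl : is_psymplectic omega) (dimV : \dim {:V} = (2 * n)%N)
    (L : {vspace V}) (L_lagr : lagrangian omega n L)
    (U : {vspace V}) (UL : (U <= L)%VS)
    (rho : 'Hom(subvs_of L, quot L) -> R) (rho_cov : covector omega n rho) :
  characteristic omega n rho U <->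
  (forall alpha beta : 'Hom(subvs_of L, R^o),
     annihilator U alpha -> annihilator U beta ->
     grho omega n rho alpha beta = 0).
Proof.
have Liso := L_lagr.2.
split=> [[_ _ rho0] alpha beta alphaU betaU|g0].
  have [X [Xtan XE ->]] := grhoE omega_sympl dimV L_lagr rho alpha beta.
  apply: rho0; apply: tangent_prolongation => // u w uU.
  rewrite XE /symprod (alphaU _ uU) (betaU _ uU).
  by rewrite !mul0r addr0 mulr0.
split=> // [u v uU vU|X Xprol].
  exact: Liso (subvP UL _ uU) (subvP UL _ vU).
have Xtan : tangent (lagrangian omega n) X.
  case: Xprol => c [c_prol vel]; exists c; split=> //.
  by apply: filterS c_prol => t [].
have Xsym := (tangent_lagrangianP omega_sympl dimV L_lagr X).1 Xtan.
have XU := tangent_prolongation_vanish Liso Xprol.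
have [c [alpha [alphaU XE]]] := symmetric_form_decomposition UL
  (hform_scalarr omega X) (hform_scalarl omega X) Xsym XU.
have ex k : exists Y, [/\ tangent (lagrangian omega n) Y,
    forall v w, hform omega Y v w = symprod (alpha k.1) (alpha k.2) v w
  & rho Y = 0].
  have [Y [Ytan YE Yrho]] :=
    grhoE omega_sympl dimV L_lagr rho (alpha k.1) (alpha k.2).
  by exists Y; split=> //; rewrite -Yrho; exact: g0.
have [Y YP] := choice ex.
have -> : X = \sum_k c k *: Y k.
  apply: (hform_inj omega_sympl dimV L_lagr) => v w.
  rewrite XE (scalar_sum _ _ (hform_scalar _ v w)).
  by apply: eq_bigr => k _; have [_ -> _] := YP k.
rewrite (covector_sum omega_sympl dimV L_lagr) //.
  by rewrite big1 // => k _; have [_ _ ->] := YP k; rewrite mulr0.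
by move=> k; have [] := YP k.
Qed.
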